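(* Let $m\in\{0,\dots,N_x-1\}$ and let $v_k\in\mathbb R^{N_v}$ satisfy $Av_k=\lambda_kv_k$, $\|v_k\|_2=1$. If $U^n=x_mv_k^T$, then one step of the PtD--PSI scheme (defined in the context) gives $$U^{n+1}=g^{\rm PtD}_{m,k}U^n,\qquad g^{\rm PtD}_{m,k}=p_{m,k}(1+i\nu_kz_m)(1-i\nu_kz_m),$$ with $$p_{m,k}:=1-\nu y_m-i\nu_kz_m,\qquad \nu_k:=\lambda_k\frac{\Delta t}{\Delta x}.$$ Consequently, $$|g^{\rm PtD}_{m,k}|^2=\bigl((1-\nu y_m)^2+\nu_k^2z_m^2\bigr)\bigl(1+\nu_k^2z_m^2\bigr)^2.$$ If, in addition, $|\lambda_k|=\lambda_{\max}$, then $|\nu_k|=\nu$ and $$|g^{\rm PtD}_{m,k}|^2=h_{\rm PtD}(y_m,\nu),\qquad h_{\rm PtD}(y,\nu):=\bigl[1+2y\nu(\nu-1)\bigr]\bigl[1+\nu^2y(2-y)\bigr]^2.$$ Moreover, $h_{\rm PtD}(y,\nu)\le 1$ for all $y\in[0,2]$ when $0\le\nu\le\frac13$, whereas $h_{\rm PtD}(y,\nu)>1$ for all sufficiently small $y>0$ when $\nu>\frac13$.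
   Context: Let $A\in\mathbb R^{N_v\times N_v}$ be symmetric, $\lambda_{\max}:=\|A\|_2$ (spectral norm), $\Delta t,\Delta x>0$, and $\nu:=\lambda_{\max}\frac{\Delta t}{\Delta x}>0$. Let $E_+,E_-\in\mathbb R^{N_x\times N_x}$ be the periodic shift matrices $(E_+w)_j=w_{j+1}$, $(E_-w)_j=w_{j-1}$ (indices modulo $N_x$), and $M_1=E_+-E_-$, $M_2=2I-E_+-E_-$. For $m=0,\dots,N_x-1$ the Fourier mode $x_m\in\mathbb C^{N_x}$ is $(x_m)_j:=\frac{1}{\sqrt{N_x}}e^{ij\alpha_m}$, $\alpha_m:=\frac{2\pi m}{N_x}$, $j=1,\dots,N_x$, and $y_m:=1-\cos\alpha_m$, $z_m:=\sin\alpha_m$. PtD--PSI scheme of rank $r$: from $U^n=X^nS^n(V^n)^T$, with $X^n$ ($N_x\times r$) and $V^n$ ($N_v\times r$) having orthonormal columns, put $\widetilde A:=(V^n)^TAV^n$. One step is: K-step: $K^n=X^nS^n$, $K^{n+1}=K^n-\frac{\Delta t}{2\Delta x}M_1K^n\widetilde A-\frac{\nu}{2}M_2K^n$; take a QR factorization $K^{n+1}=X^{n+1}S^{(1)}$ with $X^{n+1}$ having orthonormal columns. S-step: $S^{(2)}=S^{(1)}+\frac{\Delta t}{2\Delta x}(X^{n+1})^*M_1X^{n+1}S^{(1)}\widetilde A$. L-step: $L^n=S^{(2)}(V^n)^T$, $L^{n+1}=L^n-\frac{\Delta t}{2\Delta x}(X^{n+1})^*M_1X^{n+1}L^nA$;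 take a QR factorization $(L^{n+1})^T=V^{n+1}(S^{n+1})^T$. Then $U^{n+1}=X^{n+1}L^{n+1}$. Here $X^*$ denotes the conjugate transpose (equal to $X^T$ for real factors). For the single-mode state $U^n=x_mv_k^T$ the scheme is run with $r=1$, $X^n=x_m$, $S^n=1$, $V^n=v_k$, and complex entries are allowed in $X$, $S$ and $L$. *)

(* Defs.v *)
From mathcomp Require Export all_boot all_order all_algebra.
From mathcomp Require Export complex.
From mathcomp Require Export all_classical all_reals all_analysis.

Set Implicit Arguments.
Unset Strict Implicit.
Unset Printing Implicit Defensive.

Import Order.TTheory GRing.Theory Num.Theory.
Import numFieldNormedType.Exports.

Local Open Scope ring_scope.
Local Open Scope classical_set_scope.
Local Open Scope complex_scope.
Local Open Scope sesquilinear_scope.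

Definition l2norm (R : realType) (n : nat) (v : 'cV[R]_n) : R :=
  Num.sqrt (\sum_(i < n) v i 0 ^+ 2).

Definition spectral_norm (R : realType) (n : nat) (A : 'M[R]_n) : R :=
  sup [set l2norm (A *m v) | v in [set v : 'cV[R]_n | l2norm v <= 1]].

Definition cfl (R : realType) (n : nat) (A : 'M[R]_n) (dt dx : R) : R :=
  spectral_norm A * (dt / dx).

Definition complexify (R : realType) (p q : nat) (M : 'M[R]_(p, q)) :
  'M[R[i]]_(p, q) := map_mx (real_complex R) M.

(* [ordS] and [ord_pred] are the cyclic successor and predecessor on ['I_n]. *)
Definition shiftp (R : realType) (n : nat) : 'M[R]_n :=
  \matrix_(j < n, l < n) (l == ordS j)%:R.

Definition shiftm (R : realType) (n : nat) : 'M[R]_n :=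
  \matrix_(j < n, l < n) (l == ord_pred j)%:R.

Definition M1 (R : realType) (n : nat) : 'M[R]_n := shiftp R n - shiftm R n.

Definition M2 (R : realType) (n : nat) : 'M[R]_n :=
  2%:M - shiftp R n - shiftm R n.

Definition expi (R : realType) (t : R) : R[i] := cos t +i* sin t.

Definition alpha (R : realType) (Nx : nat) (m : 'I_Nx) : R :=
  2 * pi * m%:R / Nx%:R.

(* Grid points are numbered 1, ..., Nx, while ['I_Nx] starts at 0. *)
Definition fourier_mode (R : realType) (Nx : nat) (m : 'I_Nx) : 'cV[R[i]]_Nx :=
  \col_(j < Nx) (((Num.sqrt (Nx%:R : R))^-1)%:C * expi (j.+1%:R * alpha R m)).

Definition orthonormal_cols (R : realType) (p q : nat) (X : 'M[R[i]]_(p, q)) :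
  Prop := X ^t* *m X = 1%:M.

(* [is_trig_mx] means lower triangular. *)
Definition is_QR (R : realType) (p q : nat)
    (M Q : 'M[R[i]]_(p, q)) (T : 'M[R[i]]_q) : Prop :=
  [/\ M = Q *m T, orthonormal_cols Q & is_trig_mx T^T].

(* One step from U^n = X0 S0 V0^T to U1 = U^{n+1}, with new factors X1, S1, V1.
   It is a relation because QR factorizations are not unique; the factor in the
   velocity variable is real, all others may be complex. *)
Definition ptd_psi_step (R : realType) (Nx Nv r : nat)
    (A : 'M[R]_Nv) (dt dx : R)
    (X0 : 'M[R[i]]_(Nx, r)) (S0 : 'M[R[i]]_r) (V0 : 'M[R]_(Nv, r))
    (X1 : 'M[R[i]]_(Nx, r)) (S1 : 'M[R[i]]_r) (V1 : 'M[R]_(Nv, r))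
    (U1 : 'M[R[i]]_(Nx, Nv)) : Prop :=
  let c : R[i] := (dt / (2 * dx))%:C in
  let D1 := complexify (M1 R Nx) in
  let D2 := complexify (M2 R Nx) in
  let At := complexify (V0^T *m A *m V0) in
  let K0 := X0 *m S0 in
  let K1 := K0 - c *: (D1 *m K0 *m At) - (cfl A dt dx / 2)%:C *: (D2 *m K0) in
  let B := X1 ^t* *m D1 *m X1 in
  exists Sig1 : 'M[R[i]]_r,
  let Sig2 := Sig1 + c *: (B *m Sig1 *m At) in
  let L0 := Sig2 *m (complexify V0)^T in
  let L1 := L0 - c *: (B *m L0 *m complexify A) in
  [/\ orthonormal_cols X0 /\ orthonormal_cols (complexify V0),
      is_QR K1 X1 Sig1,
      is_QR L1^T (complexify V1) S1^T
    & U1 = X1 *m L1].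

Definition p_ptd (R : realType) (nu nuk y z : R) : R[i] :=
  (1 - nu * y) -i* (nuk * z).

Definition g_ptd (R : realType) (nu nuk y z : R) : R[i] :=
  p_ptd nu nuk y z * (1 +i* (nuk * z)) * (1 -i* (nuk * z)).

Definition h_ptd (R : realType) (y nu : R) : R :=
  (1 + 2 * y * nu * (nu - 1)) * (1 + nu ^+ 2 * y * (2 - y)) ^+ 2.

(* Main.v *)
(* The Fourier mode x_m is an eigenvector of M_1 (eigenvalue 2 i z_m) and of M_2
   (eigenvalue 2 y_m), so the K-step multiplies it by p and X^{n+1} is a scalar
   multiple of x_m unless p = 0. Then (X^{n+1})^* M_1 X^{n+1} = 2 i z_m, and the
   S- and L-steps multiply the coefficient by 1 + i nu_k z_m and 1 - i nu_k z_m.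
   If p = 0, then X^{n+1} is arbitrary but S^(1) = 0, so U^{n+1} = 0.

   With a = nu^2 y (2 - y), the bound h <= 1 follows from
   2 y nu (1 - nu) >= 2 a for nu <= 1/3 and (1 - 2 a) (1 + a)^2 <= 1; for
   nu > 1/3 the slope of h at y = 0 is 2 nu (3 nu - 1) > 0. *)

Require Import Defs.
From mathcomp Require Import ring lra.

Set Implicit Arguments.
Unset Strict Implicit.
Unset Printing Implicit Defensive.

Import Order.TTheory GRing.Theory Num.Theory.
Import numFieldNormedType.Exports.
Local Open Scope ring_scope.
Local Open Scope classical_set_scope.
Local Open Scope complex_scope.
Local Open Scope sesquilinear_scope.

(** * Fourier modes as eigenvectors of the periodic difference matrices *)

Lemma expiD (R : realType) (s t : R) : expi (s + t) = expi s * expi t.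
Proof.
rewrite /expi cosD sinD; simpc; congr (_ +i* _).
by rewrite addrC [_ * cos t]mulrC.
Qed.

Lemma conjc_expi_mul (R : realType) (t : R) : (expi t)^* * expi t = 1.
Proof.
rewrite /expi; simpc; apply/eqP; rewrite eq_complex /=; apply/andP; split; apply/eqP.
  by rewrite -!expr2 cos2Dsin2.
by rewrite mulrC subrr.
Qed.

(** Since [Nx * alpha] equals [2 pi m], multiples of [Nx] only add full turns; this absorbs the
    wrap-around of the periodic shifts. *)
Lemma expi_alpha_modn (R : realType) (Nx : nat) (m : 'I_Nx) (k : nat) :
  expi ((k %% Nx)%:R * alpha R m) = expi (k%:R * alpha R m).
Proof.
have Nx0 : Nx%:R != 0 :> R by rewrite pnatr_eq0 -lt0n; case: m => i /(leq_trans _) ->.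
rewrite {2}(divn_eq k Nx) natrD mulrDl natrM.
have -> : (k %/ Nx)%:R * Nx%:R * alpha R m + (k %% Nx)%:R * alpha R m =
    (k %% Nx)%:R * alpha R m + pi *+ 2 *+ (k %/ Nx * m).
  rewrite addrC -[pi *+ 2 *+ _]mulr_natl natrM -[pi *+ 2]mulr_natl /alpha.
  by congr (_ + _); field.
by rewrite /expi (periodicn (@cosD2pi R)) (periodicn (@sinD2pi R)).
Qed.

Lemma fourier_mode_ordS (R : realType) (Nx : nat) (m j : 'I_Nx) :
  fourier_mode R m (ordS j) 0 = expi (alpha R m) * fourier_mode R m j 0.
Proof.
rewrite !mxE [RHS]mulrCA; congr (_ * _).
(* The entry at [ordS j] has grid number [(j.+1 %% Nx) + 1], so one [alpha] is split off before the
   modulus is removed. *)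
rewrite -[in LHS]natr1 mulrDl mul1r expiD expi_alpha_modn mulrC.
by congr (_ * _).
Qed.

Lemma shiftp_fourier (R : realType) (Nx : nat) (m : 'I_Nx) :
  complexify (shiftp R Nx) *m fourier_mode R m = expi (alpha R m) *: fourier_mode R m.
Proof.
apply/colP => j; rewrite [RHS]mxE -fourier_mode_ordS mxE (bigD1 (ordS j)) //=.
rewrite big1 => [|l /negPf lj]; rewrite mxE [shiftp _ _ _ _]mxE ?lj ?eqxx.
  by rewrite addr0 rmorph1 mul1r.
by rewrite rmorph0 mul0r.
Qed.

Lemma shiftm_fourier (R : realType) (Nx : nat) (m : 'I_Nx) :
  complexify (shiftm R Nx) *m fourier_mode R m
  = (expi (alpha R m))^* *: fourier_mode R m.
Proof.
(* Writing [j] as [ordS (ord_pred j)] reduces to the forward shift, whose phase is cancelled by its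
   conjugate. *)
apply/colP => j; rewrite [RHS]mxE -{2}(ord_predK j) fourier_mode_ordS mulrA.
rewrite conjc_expi_mul mul1r mxE (bigD1 (ord_pred j)) //=.
rewrite big1 => [|l /negPf lj]; rewrite mxE [shiftm _ _ _ _]mxE ?lj ?eqxx.
  by rewrite addr0 rmorph1 mul1r.
by rewrite rmorph0 mul0r.
Qed.

Lemma M1_fourier (R : realType) (Nx : nat) (m : 'I_Nx) :
  complexify (M1 R Nx) *m fourier_mode R m
  = (0 +i* (2 * sin (alpha R m))) *: fourier_mode R m.
Proof.
rewrite /complexify /M1 map_mxB mulmxBl shiftp_fourier shiftm_fourier -scalerBl.
by congr (_ *: _); rewrite /expi; simpc; congr (_ +i* _); ring.
Qed.

Lemma M2_fourier (R : realType) (Nx : nat) (m : 'I_Nx) :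
  complexify (M2 R Nx) *m fourier_mode R m
  = (2 * (1 - cos (alpha R m)))%:C *: fourier_mode R m.
Proof.
rewrite /complexify /M2 !map_mxB !mulmxBl shiftp_fourier shiftm_fourier.
rewrite map_scalar_mx mul_scalar_mx -!scalerBl.
by congr (_ *: _); rewrite /expi; simpc; congr (_ +i* _); ring.
Qed.

(** * Orthonormality and the projected difference matrix *)

Lemma fourier_orthonormal (R : realType) (Nx : nat) (m : 'I_Nx) :
  orthonormal_cols (fourier_mode R m).
Proof.
have Nx0 : (0 < Nx)%N by case: m => i /(leq_trans _) ->.
apply/matrixP => i j; rewrite !ord1 !mxE eqxx /=.
rewrite (eq_bigr (fun=> (Nx%:R^-1 : R)%:C)) => [|l _].
  rewrite sumr_const card_ord -rmorphMn /= -[_ *+ Nx]mulr_natr mulVf //.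
  by rewrite pnatr_eq0 -lt0n.
rewrite !mxE [X in X * _](_ : _ = ((Num.sqrt (Nx%:R : R))^-1)%:C
    * (expi (l.+1%:R * alpha R m))^*); last first.
  by rewrite -[in RHS]conjc_real; exact: (rmorphM (@conjc R)).
rewrite mulrACA conjc_expi_mul mulr1 -rmorphM /= -invfM -expr2.
by rewrite sqr_sqrtr.
Qed.

(* [X1] is a multiple of [x], hence an eigenvector of [D] for the same [a]. *)
Lemma galerkin_scalar (R : realType) (n : nat) (x X1 : 'cV[R[i]]_n) (D : 'M[R[i]]_n)
    (a p s : R[i]) :
  orthonormal_cols x -> orthonormal_cols X1 -> D *m x = a *: x ->
  p *: x = s *: X1 -> s != 0 -> X1 ^t* *m D *m X1 = a%:M.
Proof.
move=> x1 X11 Dx e s0.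
have X1E : X1 = (s^-1 * p) *: x by rewrite -scalerA e scalerA mulVf ?scale1r.
have DX : D *m X1 = a *: X1.
  by rewrite X1E -scalemxAr Dx !scalerA mulrC.
by rewrite -mulmxA DX -scalemxAr X11 scalemx1.
Qed.

Lemma l2norm1_trmul (R : realType) (n : nat) (v : 'cV[R]_n) :
  l2norm v = 1 -> v^T *m v = 1%:M.
Proof.
move=> v1; apply/matrixP => i j; rewrite !ord1 !mxE eqxx /=.
rewrite (eq_bigr (fun k => v k 0 ^+ 2)) => [|k _]; last by rewrite mxE expr2.
rewrite -[LHS]sqr_sqrtr; last by apply: sumr_ge0 => k _; exact: sqr_ge0.
by rewrite -/(l2norm v) v1 expr1n.
Qed.

Lemma complexify_orthonormal (R : realType) (n : nat) (v : 'cV[R]_n) :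
  v^T *m v = 1%:M -> orthonormal_cols (complexify v).
Proof.
move=> v1; have -> : orthonormal_cols (complexify v) =
    ((complexify v)^T *m complexify v = 1%:M).
  congr (_ *m _ = _); apply/matrixP => i j; rewrite !mxE; exact: conjc_real.
by rewrite /complexify map_trmx -map_mxM v1 map_mx1.
Qed.

(** * Modulus of the amplification factor and bounds on [h_ptd] *)

Lemma normc_g_ptd (R : realType) (nu nuk y z : R) :
  `|g_ptd nu nuk y z| ^+ 2 = (((1 - nu * y) ^+ 2 + nuk ^+ 2 * z ^+ 2)
                   * (1 + nuk ^+ 2 * z ^+ 2) ^+ 2)%:C.
Proof.
by rewrite /g_ptd /p_ptd -add_Re2_Im2 /=; congr (_ %:C); ring.
Qed.

(** With [y = 1 - cos t] the squared sine is [y (2 - y)], and the terms in [y^2] of the first factor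
    cancel. *)
Lemma h_ptd_sqr (R : realType) (nu nuk t : R) : nuk ^+ 2 = nu ^+ 2 ->
  ((1 - nu * (1 - cos t)) ^+ 2 + nuk ^+ 2 * sin t ^+ 2)
    * (1 + nuk ^+ 2 * sin t ^+ 2) ^+ 2 = h_ptd (1 - cos t) nu.
Proof. by move=> ->; rewrite sin2cos2 /h_ptd; ring. Qed.

Lemma h_ptd_le1 (R : realType) (mu y : R) :
  0 <= mu <= 3^-1 -> 0 <= y <= 2 -> h_ptd y mu <= 1.
Proof.
move=> mu01 y02; rewrite /h_ptd.
set a := mu ^+ 2 * y * (2 - y).
have a0 : 0 <= a by rewrite !mulr_ge0 ?sqr_ge0 //; lra.
have c_le : 1 + 2 * y * mu * (mu - 1) <= 1 - 2 * a.
  rewrite /a -subr_ge0.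
  (* The threshold 1/3 enters through the factor [1 - 3 * mu]. *)
  rewrite [leRHS](_ : _ = 2 * (y * mu * ((1 - 3 * mu) + mu * y))); last by ring.
  have mu0 : 0 <= mu by lra.
  have y0 : 0 <= y by lra.
  by rewrite mulr_ge0 // mulr_ge0 ?mulr_ge0 // addr_ge0 ?mulr_ge0 // subr_ge0; lra.
apply: (le_trans (ler_wpM2r (sqr_ge0 _) c_le)).
(* The terms linear in [a] cancel: [(1 - 2 a) (1 + a)^2 = 1 - 3 a^2 - 2 a^3]. *)
rewrite -subr_ge0 [leRHS](_ : _ = a ^+ 2 * (3 + 2 * a)); last by ring.
by rewrite mulr_ge0 ?sqr_ge0 //; lra.
Qed.

Lemma h_ptd_gt1 (R : realType) (mu : R) :
  3^-1 < mu -> \forall y \near (0 : R)^'+, 1 < h_ptd y mu.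
Proof.
move=> mu3.
(* The slope at 0 divided by the size of the negative quadratic coefficient in the expansion at the
   end: for smaller [y] the linear term wins. *)
have d0 : 0 < 2 * mu * (3 * mu - 1) / (2 * mu ^+ 2 + 8 * mu ^+ 3).
  by rewrite divr_gt0 ?addr_gt0 ?mulr_gt0 ?exprn_gt0 //; lra.
(* Below this bound the first factor of [h_ptd] is nonnegative, so [(1 + a)^2] may be replaced by
   its lower bound [1 + 2 a]. *)
have e0 : 0 < (2 * mu)^-1 by rewrite invr_gt0; lra.
near=> y.
have y0 : 0 < y by near: y; exact: nbhs_right_gt.
have y2 : y < 2 by near: y; exact: nbhs_right_lt.
have yd : y < 2 * mu * (3 * mu - 1) / (2 * mu ^+ 2 + 8 * mu ^+ 3).
  by near: y; exact: nbhs_right_lt.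
have ye : y < (2 * mu)^-1 by near: y; exact: nbhs_right_lt.
rewrite ltr_pdivlMr in yd; last first.
  by rewrite addr_gt0 ?mulr_gt0 ?exprn_gt0 //; lra.
rewrite -[X in _ < X]mul1r ltr_pdivlMr in ye; last by lra.
rewrite /h_ptd; set a := mu ^+ 2 * y * (2 - y).
have a0 : 0 <= a by rewrite !mulr_ge0 ?sqr_ge0 //; lra.
have mu0 : 0 < mu by lra.
have b0 : 0 <= 1 + 2 * y * mu * (mu - 1).
  have ymu2 : 0 <= y * mu ^+ 2 by rewrite mulr_ge0 ?sqr_ge0 // ltW.
  rewrite [leRHS](_ : _ = (1 - y * (2 * mu)) + 2 * (y * mu ^+ 2)); last by ring.
  by lra.
apply: (@lt_le_trans _ _ ((1 + 2 * y * mu * (mu - 1)) * (1 + 2 * a))); last first.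
  apply: ler_wpM2l => //.
  rewrite -subr_ge0 [leRHS](_ : _ = a ^+ 2); last by ring.
  exact: sqr_ge0.
rewrite -subr_gt0 [ltRHS](_ : _ = y * (2 * mu * (3 * mu - 1)
    - y * (2 * mu ^+ 2 + 8 * mu ^+ 3)
    + 4 * mu ^+ 3 * y * (mu * (2 - y) + y))); last by rewrite /a; ring.
have ymu3 : 0 <= 4 * mu ^+ 3 * y by rewrite !mulr_ge0 ?exprn_ge0 // ltW.
rewrite mulr_gt0 // ltr_wpDr ?subr_gt0 // mulr_ge0 // addr_ge0 ?ltW //.
by rewrite mulr_gt0 // subr_gt0.
Unshelve. all: by end_near.
Qed.

(** * The substeps on a single mode *)

Lemma K_step_fourier (R : realType) (Nx : nat) (m : 'I_Nx) (dt dx nu lambda : R) :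
  dx != 0 ->
  let xm := fourier_mode R m in
  xm - (dt / (2 * dx))%:C *: (complexify (M1 R Nx) *m xm *m complexify lambda%:M)
     - (nu / 2)%:C *: (complexify (M2 R Nx) *m xm)
  = p_ptd nu (lambda * (dt / dx)) (1 - cos (alpha R m)) (sin (alpha R m)) *: xm.
Proof.
move=> dx0 xm; rewrite M1_fourier M2_fourier /complexify map_scalar_mx.
rewrite mul_mx_scalar !scalerA -{1}[xm]scale1r -!scalerBl; congr (_ *: _).
by rewrite /p_ptd; simpc; congr (_ +i* _); field.
Qed.

(** Symmetry of [A] makes [v^T] a left eigenvector, so the S- and L-steps see the same [lambda];
    their opposite signs produce conjugate factors. Here [s] stands for the scalar left by the
    K-step. *)
Lemma SL_step_scalar (R : realType) (n : nat) (A : 'M[R]_n) (v : 'cV[R]_n)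
    (lambda dt dx z : R) (s : R[i]) :
  A *m v = lambda *: v -> A^T = A -> dx != 0 ->
  let c := (dt / (2 * dx))%:C in
  let B : 'M[R[i]]_1 := (0 +i* (2 * z))%:M in
  let L0 := (s%:M + c *: (B *m s%:M *m complexify lambda%:M)) *m (complexify v)^T in
  let w := lambda * (dt / dx) * z in
  L0 - c *: (B *m L0 *m complexify A)
  = (s * ((1 +i* w) * (1 -i* w))) *: (complexify v)^T.
Proof.
move=> Av As dx0 c B L0 w.
have vA : (complexify v)^T *m complexify A = lambda%:C *: (complexify v)^T.
  by rewrite /complexify map_trmx -map_mxM -{1}As -trmx_mul Av linearZ /= map_mxZ.
have -> : L0 = (s * (1 +i* w)) *: (complexify v)^T.
  rewrite /L0 /B /complexify map_scalar_mx -!scalar_mxM scale_scalar_mx -raddfD /=.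
  rewrite mul_scalar_mx; congr (_ *: _).
  have -> : 1 +i* w = 1 + c * (0 +i* (2 * z)) * lambda%:C.
    by rewrite /c /w; simpc; congr (_ +i* _); field.
  by ring.
rewrite /B mul_scalar_mx -!scalemxAl vA !scalerA -scalerBl; congr (_ *: _).
have -> : 1 -i* w = 1 - c * (0 +i* (2 * z)) * lambda%:C.
  by rewrite /c /w; simpc; congr (_ +i* _); field.
by ring.
Qed.

Theorem proposition3p5 (R : realType) (Nx Nv : nat) (A : 'M[R]_Nv) (dt dx : R)
    (m : 'I_Nx) (vk : 'cV[R]_Nv) (lambdak : R)
    (A_sym : A^T = A) (dt_gt0 : 0 < dt) (dx_gt0 : 0 < dx)
    (nu_gt0 : 0 < cfl A dt dx)
    (vk_eigen : A *m vk = lambdak *: vk) (vk_unit : l2norm vk = 1) :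
  let nu := cfl A dt dx in
  let nuk := lambdak * (dt / dx) in
  let ym := 1 - cos (alpha R m) in
  let zm := sin (alpha R m) in
  let xm := fourier_mode R m in
  let U0 := xm *m (complexify vk)^T in
  let g := g_ptd nu nuk ym zm in
  [/\ exists (X1 : 'cV[R[i]]_Nx) (S1 : 'M[R[i]]_1) (V1 : 'cV[R]_Nv)
        (U1 : 'M[R[i]]_(Nx, Nv)),
        ptd_psi_step A dt dx xm 1%:M vk X1 S1 V1 U1,
      forall (X1 : 'cV[R[i]]_Nx) (S1 : 'M[R[i]]_1) (V1 : 'cV[R]_Nv)
        (U1 : 'M[R[i]]_(Nx, Nv)),
        ptd_psi_step A dt dx xm 1%:M vk X1 S1 V1 U1 -> U1 = g *: U0,
      `|g| ^+ 2 = (((1 - nu * ym) ^+ 2 + nuk ^+ 2 * zm ^+ 2)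
                   * (1 + nuk ^+ 2 * zm ^+ 2) ^+ 2)%:C,
      `|lambdak| = spectral_norm A ->
        `|nuk| = nu /\ `|g| ^+ 2 = (h_ptd ym nu)%:C
    & (forall mu : R, 0 <= mu <= 3^-1 ->
         forall y : R, 0 <= y <= 2 -> h_ptd y mu <= 1)
      /\ (forall mu : R, 3^-1 < mu ->
         \forall y \near (0 : R)^'+, 1 < h_ptd y mu) ].
Proof.
move=> nu nuk ym zm xm U0 g.
have dx0 : dx != 0 by rewrite gt_eqF.
have vv := l2norm1_trmul vk_unit.
have At : vk^T *m A *m vk = lambdak%:M.
  by rewrite -mulmxA vk_eigen -scalemxAr vv scalemx1.
have x1 : orthonormal_cols xm := fourier_orthonormal R m.
have v1 := complexify_orthonormal vv.
have trig1 (T : 'M[R[i]]_1) : is_trig_mx T.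
  by apply/is_trig_mxP => i j; rewrite !ord1.
split.
- pose p := p_ptd nu nuk ym zm.
  pose s1 := p * ((1 +i* (nuk * zm)) * (1 -i* (nuk * zm))).
  (* Both bases are kept and the scalars go into the triangular factors, [p] being [Sig1]; [is_QR]
     allows a complex or zero diagonal. *)
  exists xm, s1%:M, vk, (xm *m (s1 *: (complexify vk)^T)), p%:M.
  rewrite /= At mulmx1 K_step_fourier //.
  have -> : xm ^t* *m complexify (M1 R Nx) *m xm = (0 +i* (2 * zm))%:M.
    by rewrite -mulmxA M1_fourier -scalemxAr x1 scalemx1.
  rewrite SL_step_scalar //; split => //; split => //.
    by rewrite mul_mx_scalar.
  by rewrite linearZ /= trmxK tr_scalar_mx mul_mx_scalar.
- move=> X1 S1 V1 U1 [Sig1]; rewrite /= At mulmx1 K_step_fourier // => -[_].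
  rewrite [Sig1]mx11_scalar; set s := Sig1 0 0 => -[].
  rewrite mul_mx_scalar => Kx X11 _ _ ->.
  (* For [s = 0] the column [X1] is undetermined, but projecting the K-step onto [xm] gives [p = 0],
     so both sides vanish. *)
  have [s0|s0] := eqVneq s 0.
    have p0 : p_ptd nu nuk ym zm = 0.
      move/(congr1 (mulmx (xm ^t*))): Kx.
      rewrite s0 scale0r mulmx0 -scalemxAr x1 => /matrixP /(_ 0 0).
      by rewrite !mxE mulr1.
    rewrite s0 -[in RHS]/nu /g /g_ptd p0 !mul0r scale0r raddf0.
    by rewrite mulmx0 mul0mx scaler0 addr0 mul0mx mulmx0 mul0mx scaler0 subr0 mulmx0.
  rewrite (galerkin_scalar x1 X11 (M1_fourier _ _) Kx s0) SL_step_scalar //.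
  (* Only the product [s *: X1 = p *: xm] enters, so the free phase of the QR factorization drops
     out. *)
  rewrite -scalemxAr [s * _]mulrC -scalerA scalemxAl -Kx -scalemxAl scalerA.
  by rewrite /g /g_ptd -[in RHS]mulrA [in RHS]mulrC.
- exact: normc_g_ptd.
- move=> lam; have nukE : `|nuk| = nu.
    by rewrite normrM lam gtr0_norm // divr_gt0.
  split=> //; rewrite normc_g_ptd h_ptd_sqr //.
  by rewrite -nukE real_normK ?num_real.
- by split; [move=> mu mu01 y; exact: h_ptd_le1 | exact: h_ptd_gt1].
Qed.
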